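(* Suppose $I$ is a set, $(A_i)_{i\in I}$ a family of groups, $C$ a group, and $h:A=\prod_{i\in I} A_i\to C$ a group homomorphism. Then the following conditions are equivalent: (a) For every partition of $I$ into a countably infinite family of subsets $J_m$ ($m\in\omega$), at least one of the subgroups $\prod_{i\in J_m} A_i\subseteq A$ lies in $\ker(h)$. (b) The homomorphism $h$ factors as $A\to A/\mathcal{U}_0\times\dots\times A/\mathcal{U}_{n-1}\to C$ (where the first arrow is the product of the quotient maps) for some finite family of ultrafilters $\mathcal{U}_0,\dots,\mathcal{U}_{n-1}$ on $I$. In this situation, the filter $$\mathcal{F}=\{J\subseteq I\mid \textstyle\prod_{i\in I-J}A_i\subseteq\ker(h)\}$$ is the intersection of the unique least set of ultrafilters that can be used in (b).
   Context: Groups are not assumed abelian. For $J\subseteq I$, $\prod_{i\in J}A_i$ is identified with the subgroup of $A=\prod_{i\in I}A_i$ consisting of the elements $a=(a_i)_{i\in I}$ whose support $\{i\in I\mid a_i\neq e\}$ is contained in $J$. For a filter (in particular, an ultrafilter) $\mathcal{U}$ on $I$, $A/\mathcal{U}$ denotes the reduced product: the quotient of $\prod_{i\in I} A_i$ by the equivalence relation $(a_i)\sim(b_i)$ iff $\{i\mid a_i=b_i\}\in\mathcal{U}$, with the induced group structure. A filter on $I$ is a set of subsets of $I$ containing $I$, closed under passing to larger subsets of $I$, and closed under pairwise intersections; it may be improper (equal to the set of all subsets of $I$). An ultrafilter is a maximal proper filter. The intersection of the empty family of ultrafilters is taken to be the set of all subsets of $I$; finite families may be empty ($n=0$), the empty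 product being the trivial group. A partition of $I$ is an expression of $I$ as the union of an indexed family of pairwise disjoint, possibly empty, subsets. *)

(* Defs.v *)
From HB Require Import structures.
From mathcomp Require Import all_boot.
From mathcomp Require Import boolp classical_sets functions filter.

(* Between groupTypes, {multiplicative G -> H} is the type of all group
   homomorphisms: preservation of 1 and of inverses follows. *)

Set Implicit Arguments.
Unset Strict Implicit.
Unset Printing Implicit Defensive.

Local Open Scope classical_set_scope.
Local Open Scope group_scope.
Local Open Scope quotient_scope.

Section ProductGroup.
Variables (I : Type) (A : I -> groupType).
Implicit Types a b c : forall i, A i.

Definition dprod_one : forall i, A i := fun=> 1.
Definition dprod_inv a : forall i, A i := fun i => (a i)^-1.
Definition dprod_mul a b : forall i, A i := fun i => a i * b i.

Fact dprod_mulgA : associative dprod_mul.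
Proof. by move=> a b c; apply: functional_extensionality_dep => i; exact: mulgA. Qed.

Fact dprod_mul1g : left_id dprod_one dprod_mul.
Proof. by move=> a; apply: functional_extensionality_dep => i; exact: mul1g. Qed.

Fact dprod_mulg1 : right_id dprod_one dprod_mul.
Proof. by move=> a; apply: functional_extensionality_dep => i; exact: mulg1. Qed.

Fact dprod_mulVg : left_inverse dprod_one dprod_inv dprod_mul.
Proof. by move=> a; apply: functional_extensionality_dep => i; exact: mulVg. Qed.

Fact dprod_mulgV : right_inverse dprod_one dprod_inv dprod_mul.
Proof. by move=> a; apply: functional_extensionality_dep => i; exact: mulgV. Qed.

HB.instance Definition _ := isGroup.Build (forall i, A i)
  dprod_mulgA dprod_mul1g dprod_mulg1 dprod_mulVg dprod_mulgV.

(* The subgroup of the product identified with the product over J. *)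
Definition subprod (J : set I) : set (forall i, A i) :=
  [set a | [set i | a i <> 1] `<=` J].

End ProductGroup.

Arguments subprod {I} A J _.

Section ReducedProduct.
Variables (I : Type) (A : I -> groupType) (F : set_system I).
Context {FF : Filter F}.
Implicit Types a b c : forall i, A i.

(* F need not be proper. *)
Definition reduced_rel : rel (forall i, A i) :=
  fun a b => `[< F [set i | a i = b i] >].

Fact reduced_rel_refl : reflexive reduced_rel.
Proof. by move=> a; apply/asboolP; apply: filterS filterT => i _. Qed.

Fact reduced_rel_sym : symmetric reduced_rel.
Proof. by move=> a b; apply/asboolP/asboolP; apply: filterS => i /= ->. Qed.

Fact reduced_rel_trans : transitive reduced_rel.
Proof.
move=> b a c /asboolP Fab /asboolP Fbc; apply/asboolP.
by apply: filterS (filterI Fab Fbc) => i [/= -> ->].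
Qed.

Canonical reduced_equiv :=
  EquivRel reduced_rel reduced_rel_refl reduced_rel_sym reduced_rel_trans.

Definition reduced_product : Type := {eq_quot reduced_rel}.

HB.instance Definition _ := Choice.on reduced_product.
HB.instance Definition _ := EqQuotient.on reduced_product.

Lemma reduced_productP a b :
  F [set i | a i = b i] <-> \pi_reduced_product a = \pi_reduced_product b.
Proof.
split=> [Fab|/eqP]; first by apply/eqP; rewrite piE; exact/asboolP.
by rewrite piE => /asboolP.
Qed.

Fact repr_reduced a : F [set i | repr (\pi_reduced_product a) i = a i].
Proof. by apply/reduced_productP; rewrite reprK. Qed.

Definition reduced_one : reduced_product := \pi_reduced_product 1.
Definition reduced_inv : reduced_product -> reduced_product :=
  lift_op1 reduced_product (fun a => a^-1).
Definition reduced_mul :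
    reduced_product -> reduced_product -> reduced_product :=
  lift_op2 reduced_product (fun a b => a * b).

Fact pi_reduced_inv : {morph \pi_reduced_product : a / a^-1 >-> reduced_inv a}.
Proof.
move=> a; unlock reduced_inv; apply/reduced_productP.
by apply: filterS (repr_reduced a) => i /= ai; congr (_^-1); rewrite ai.
Qed.

Fact pi_reduced_mul :
  {morph \pi_reduced_product : a b / a * b >-> reduced_mul a b}.
Proof.
move=> a b; unlock reduced_mul; apply/reduced_productP.
apply: filterS (filterI (repr_reduced a) (repr_reduced b)) => i /= [ai bi].
by congr (_ * _); rewrite ?ai ?bi.
Qed.

Fact reduced_mulgA : associative reduced_mul.
Proof.
by elim/quotW=> a; elim/quotW=> b; elim/quotW=> c; rewrite -!pi_reduced_mul mulgA.
Qed.

Fact reduced_mul1g : left_id reduced_one reduced_mul.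
Proof. by elim/quotW=> a; rewrite -pi_reduced_mul mul1g. Qed.

Fact reduced_mulg1 : right_id reduced_one reduced_mul.
Proof. by elim/quotW=> a; rewrite -pi_reduced_mul mulg1. Qed.

Fact reduced_mulVg : left_inverse reduced_one reduced_inv reduced_mul.
Proof. by elim/quotW=> a; rewrite -pi_reduced_inv -pi_reduced_mul mulVg. Qed.

Fact reduced_mulgV : right_inverse reduced_one reduced_inv reduced_mul.
Proof. by elim/quotW=> a; rewrite -pi_reduced_inv -pi_reduced_mul mulgV. Qed.

HB.instance Definition _ := isGroup.Build reduced_product
  reduced_mulgA reduced_mul1g reduced_mulg1 reduced_mulVg reduced_mulgV.

Definition reduced_pi : (forall i, A i) -> reduced_product :=
  \pi_reduced_product.

Fact reduced_pi_multiplicative : {morph reduced_pi : a b / a * b}.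
Proof. exact: pi_reduced_mul. Qed.

HB.instance Definition _ :=
  isMultiplicative.Build _ _ reduced_pi reduced_pi_multiplicative.

End ReducedProduct.

Arguments reduced_product {I} A F {FF}.
Arguments reduced_pi {I} A F {FF} a.

Section Ultraproducts.
Variables (I : Type) (A : I -> groupType) (C : groupType).
Variable h : {multiplicative (forall i, A i) -> C}.

Definition kernel : set (forall i, A i) := [set a | h a = 1].

Definition factors_through_ultraproducts n (U : 'I_n -> set_system I)
    {UU : forall k, UltraFilter (U k)} : Prop :=
  exists g : {multiplicative (forall k, reduced_product A (U k)) -> C},
    forall a, h a = g (fun k => reduced_pi A (U k) a).
Arguments factors_through_ultraproducts {n} U {UU}.

(* A family may have repetitions: a set of ultrafilters is usable when it is
   the range of some finite family through which h factors. *)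
Definition factoring_ultrafilters : set (set (set_system I)) :=
  [set S | exists n (U : 'I_n -> set_system I)
             (UU : forall k, UltraFilter (U k)),
           range U = S /\ factors_through_ultraproducts U].

Definition kernel_filter : set_system I :=
  [set J | subprod A (~` J) `<=` kernel].

End Ultraproducts.

Arguments factors_through_ultraproducts {I A C} h {n} U {UU}.

(* Main.v *)
(* Let F be the kernel filter and S the set of ultrafilters containing F, so
   that F is the intersection of S.  If h factors through ultraproducts over
   V_0, ..., V_(n-1), then F contains the intersection of the V_k; since a
   finite intersection of ultrafilters is contained in no other ultrafilter, S
   is a subset of {V_0, ..., V_(n-1)}.  Conversely, if S is finite, its members
   contain pairwise disjoint sets, so A maps onto the product of the
   ultraproducts over S with kernel {a | {i | a i = 1} \in F}, which lies in
   ker h.  Finally, if S is infinite, one can repeatedly cut I into two pieces,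
   one belonging to a member of S and the other to infinitely many; the pieces
   set aside form a partition of I violating (a). *)
Require Import Defs.
From HB Require Import structures.
From mathcomp Require Import all_boot.
From mathcomp Require Import boolp classical_sets functions filter.
From mathcomp Require Import cardinality.

Local Open Scope classical_set_scope.

(** * Separation of ultrafilters *)

Lemma ultrafilter_separate (I : Type) (U V : set_system I) :
  UltraFilter U -> UltraFilter V -> U <> V ->
  exists X, U X /\ V (~` X).
Proof.
move=> UU UV; apply: contra_notP => nX; apply: esym.
apply: max_filter => X UX; have [//|VX] := in_ultra_setVsetC X UV.
by case: nX; exists X.
Qed.

(** Otherwise each [V k] has a member [X k] whose complement is in [U]; the union of the [X k] lies
    in every [V k], hence in [U], and so does the finite intersection of the complements. *)
Lemma bigcap_ultrafilters_sub (I : Type) (n : nat) (V : 'I_n -> set_system I)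
    (U : set_system I) :
  (forall k, UltraFilter (V k)) -> UltraFilter U ->
  \bigcap_k V k `<=` U -> exists k, V k = U.
Proof.
move=> UV UU sVU; apply/not_existsP => nVU.
have [X XP] := choice (fun k => ultrafilter_separate _ _ _ (UV k) UU (nVU k)).
have UXC : U (fun i => forall k, (~` X k) i).
  by apply: filter_forall => k; exact: (XP k).2.
have UX : U (\bigcup_k X k).
  apply: sVU => k _; apply: filterS (XP k).1; exact: bigcup_sup.
by have [i [[k _ Xki] /(_ k)]] := filter_ex (filterI UX UXC).
Qed.

Lemma disjoint_ultrafilter_sets (I : Type) (n : nat)
    (U : 'I_n -> set_system I) :
  (forall k, UltraFilter (U k)) -> injective U ->
  exists P : 'I_n -> set I, (forall k, U k (P k)) /\ trivIset setT P.
Proof.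
move=> UU Uinj.
have /choice[X XP] (kl : 'I_n * 'I_n) : exists X,
    kl.1 <> kl.2 -> U kl.1 X /\ U kl.2 (~` X).
  have [->|/eqP kl_neq] := eqVneq kl.1 kl.2; first by exists setT.
  have [|X XP] := ultrafilter_separate _ _ _ (UU kl.1) (UU kl.2).
    by move/Uinj.
  by exists X.
(* A common point of the sets for [k] and [l] would lie both in and outside [X (k, l)]. *)
exists (fun k i => forall l, k <> l -> X (k, l) i /\ ~ X (l, k) i); split.
  move=> k; apply: filter_forall => l.
  have [->|/eqP kl] := eqVneq k l; first by apply: filterS filterT => i _ /(_ erefl).
  have lk : l <> k by exact: nesym.
  by apply: filterS (filterI (XP (k, l) kl).1 (XP (l, k) lk).2).
move=> k l _ _ [i [/(_ l) Pk /(_ k) Pl]]; apply: contrapT => kl.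
by have [Xkl _] := Pk kl; have [_ /(_ Xkl)] := Pl (nesym kl).
Qed.

(** If [J] is not in [F], then [F] and the complement of [J] generate a proper filter, and an
    ultrafilter extending it omits [J]. *)
Lemma filter_bigcap_ultrafilters (I : Type) (F : set_system I) :
  Filter F -> F = \bigcap_(U in [set U | UltraFilter U /\ F `<=` U]) U.
Proof.
move=> FF; apply/seteqP; split=> [J FJ U [_]|J SJ]; first exact.
apply: contrapT => nFJ.
have GP : ProperFilter (within (~` J) F).
  split; last exact: within_filter.
  by move=> FJ; apply/nFJ/(filterS (P := [set i | (~` J) i -> False]) _ FJ) => i /contrapT.
have [U [UU sGU]] := ultraFilterLemma GP.
have UJ : U J by apply: SJ; split=> // K FK; apply: sGU; apply: filterS FK.
have UJC : U (~` J) by apply: sGU; apply: withinT.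
by have [i []] := filter_ex (filterI UJ UJC).
Qed.

(** * Partitions from infinite sets of ultrafilters *)

Lemma infinite_ultrafilters_split (I : Type) (S : set (set_system I))
    (Z : set I) :
  (forall U, S U -> UltraFilter U) -> infinite_set [set U | S U /\ U Z] ->
  exists Y, [/\ Y `<=` Z, infinite_set [set U | S U /\ U Y]
    & exists2 U, S U & U (Z `\` Y)].
Proof.
move=> SU Zinf.
have [U [SUU UZ]] := infinite_setN0 Zinf.
have [V [[SV VZ] /= VU]] :=
  infinite_setN0 (infinite_setD Zinf (finite_set1 U)).
have UU := SU _ SUU; have UV := SU _ SV.
have [X [UX VX]] := ultrafilter_separate _ _ _ UU UV (nesym VU).
(* Each member of [S] containing [Z] contains one of the halves into which [X] cuts [Z]. A half in
   infinitely many members is kept; the other is in [U] or [V]. *)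
have [fX|nfX] := pselect (finite_set [set U | S U /\ U (Z `&` X)]).
  exists (Z `\` X); split; first exact: subDsetl.
    move=> fXC; apply: Zinf.
    apply: (@sub_finite_set _ _ ([set U | S U /\ U (Z `&` X)] `|`
        [set U | S U /\ U (Z `\` X)])); last by rewrite finite_setU.
    move=> W [SW WZ]; have UW := SU _ SW.
    by have [WX|WX] := in_ultra_setVsetC X UW; [left|right];
      split=> //; exact: filterI.
  by exists U => //; rewrite setDD; exact: filterI.
exists (Z `&` X); split=> //; exists V => //.
by apply: filterS (filterI VZ VX) => i [Zi nXi]; split=> // -[].
Qed.

Lemma infinite_ultrafilters_partition (I : Type) (S : set (set_system I)) :
  (forall U, S U -> UltraFilter U) -> infinite_set S ->
  exists J : nat -> set I, [/\ trivIset setT J, \bigcup_m J m = setT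
    & forall m, exists2 U, S U & U (J m)].
Proof.
move=> SU Sinf.
pose large Z := infinite_set [set U | S U /\ U Z].
have /choice[f fP] Z : exists Y, large Z ->
    [/\ Y `<=` Z, large Y & exists2 U, S U & U (Z `\` Y)].
  have [/(infinite_ultrafilters_split _ _ _ SU)[Y YP]|] := pselect (large Z).
    by exists Y.
  by exists setT.
pose Z m := iter m f setT.
have Zlarge m : large (Z m).
  elim: m => [|m /fP[]//] fS; apply: Sinf; apply: sub_finite_set fS => U SUU.
  by have := SU _ SUU; split=> //; exact: filterT.
have Zsub m : Z m.+1 `<=` Z m by have [] := fP _ (Zlarge m).
have Zmono m n : (m <= n)%N -> Z n `<=` Z m.
  by move=> /subnK <-; elim: (n - m)%N => // k IHk i /Zsub; exact: IHk.
(* The intersection of the Z m, covered by no difference Z m `\` Z m.+1, is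
   added to the 0th piece. *)
pose J m := (Z m `\` Z m.+1) `|` [set i | m = 0 /\ forall l, Z l i].
exists J; split.
- apply: ltn_trivIset => n m mn; apply/seteqP; split=> // i [].
  move=> [[_ nZ]|[_ Zi]] [[Zn nZn]|[n0 Zi']].
  + by apply: nZ; exact: Zmono Zn.
  + exact/nZ/Zi'.
  + exact/nZn/Zi.
  + by rewrite n0 in mn.
- apply/seteqP; split=> // i _; apply: contrapT => nJ.
  have Zi m : Z m i.
    elim: m => // m Zmi; apply: contrapT => nZ.
    by apply: nJ; exists m => //; left.
  by apply: nJ; exists 0 => //; right.
- move=> m; have [_ _ [U SUU UZ]] := fP _ (Zlarge m).
  exists U => //; have UU := SU _ SUU.
  by apply: filterS UZ => i; left.
Qed.

(** * Homomorphisms on product groups *)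

Local Open Scope group_scope.

(* [gmulf1] and [gmulfF] are stated for unital morphisms, a structure that
   is not inferred for a bare multiplicative map between groups. *)
Lemma multiplicative1 (G H : groupType) (f : {multiplicative G -> H}) : f 1 = 1.
Proof. by apply: (@mulgI _ (f 1)); rewrite -gmulfM !mulg1. Qed.

Lemma multiplicativeF (G H : groupType) (f : {multiplicative G -> H}) :
  {morph f : x y / x / y}.
Proof.
move=> x y; apply: (@mulIg _ (f y)).
by rewrite -gmulfM !mulgVK.
Qed.

(** Applying [h] to chosen preimages under [p] is multiplicative because [h] is constant on the
    fibres of [p]. *)
Lemma factor_surjective_morphism (G H C : groupType) (p : G -> H)
    (h : {multiplicative G -> C}) :
  {morph p : a b / a * b} -> (forall y, exists x, p x = y) ->
  (forall a b, p a = p b -> h a = h b) ->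
  exists g : {multiplicative H -> C}, forall a, h a = g (p a).
Proof.
move=> pM /choice[s sK] ker.
pose g y := h (s y).
have gM : {morph g : x y / x * y}.
  by move=> x y; rewrite /g -gmulfM; apply: ker; rewrite pM !sK.
pose gMixin := isMultiplicative.Build _ _ g gM.
pose gm : {multiplicative H -> C} := HB.pack g gMixin.
exists gm => a /=.
by apply: ker; rewrite sK.
Qed.

Section KernelFilter.
Variables (I : Type) (A : I -> groupType) (C : groupType).
Variable h : {multiplicative (forall i, A i) -> C}.

Lemma kernel_filter_eq (a b : forall i, A i) :
  kernel_filter h [set i | a i = b i] -> h a = h b.
Proof.
move=> Fab; apply: divg1_eq; rewrite -multiplicativeF; apply: Fab => i /= nab abi.
by apply: nab; change (a i / b i = 1); rewrite abi mulgV.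
Qed.

Lemma kernel_filter_filter : Filter (kernel_filter h).
Proof.
split.
- move=> a a1; suff -> : a = 1 by exact: multiplicative1.
  apply: functional_extensionality_dep => i; apply: contrapT => ai.
  exact: (a1 i ai).
- move=> J K FJ FK a aJK; rewrite /kernel /=.
  (* [b] is supported off [J], and [a / b] is supported in [J] and off [K]. *)
  pose b i := if `[< J i >] then 1 else a i.
  have hb : h b = 1.
    by apply: FJ => i /= bi Ji; apply: bi; rewrite /b asboolT.
  rewrite -hb; apply: divg1_eq; rewrite -multiplicativeF; apply: FK => i /= abi Ki.
  apply: abi; change (a i / b i = 1); rewrite /b; case: asboolP => Ji.
    apply: contrapT; rewrite divg1 => ai.
    by have /= := aJK _ ai; case.
  exact: mulgV.
- move=> J K JK FJ a aK; apply: FJ; apply: subset_trans aK _; exact: subsetC.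
Qed.

Lemma factors_bigcap_sub n (U : 'I_n -> set_system I)
    (UU : forall k, UltraFilter (U k)) :
  factors_through_ultraproducts h U -> \bigcap_k U k `<=` kernel_filter h.
Proof.
move=> [g hg] J UJ a aJ; rewrite /kernel /= hg -(multiplicative1 _ _ g); congr (g _).
apply: functional_extensionality_dep => k; apply/reduced_productP.
apply: filterS (UJ k Logic.I) => i Ji; apply: contrapT => ai.
exact: aJ ai Ji.
Qed.

Lemma bigcap_sub_factors n (U : 'I_n -> set_system I)
    (UU : forall k, UltraFilter (U k)) :
  injective U -> \bigcap_k U k `<=` kernel_filter h ->
  factors_through_ultraproducts h U.
Proof.
move=> Uinj sUF.
have [a b|x|a b pab|g hg] := factor_surjective_morphism _ _ _
    (fun a k => reduced_pi A (U k) a) h; last by exists g.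
- by apply: functional_extensionality_dep => k; exact: gmulfM.
- have [P [UP Pdisj]] := disjoint_ultrafilter_sets _ _ _ UU Uinj.
  have /choice[s sP] k : exists s, reduced_pi A (U k) s = x k.
    by exists (repr (x k)); exact: reprK.
  (* The representatives [s k] are glued along the disjoint sets [P k], which suffices since [P k]
     is in [U k]. *)
  pose a i := if pselect (exists k, P k i) is left e
              then s (projT1 (cid e)) i else 1.
  exists a; apply: functional_extensionality_dep => k.
  rewrite -sP; apply/reduced_productP; apply: filterS (UP k) => i Pki /=.
  rewrite /a; case: pselect => [e|[]]; last by exists k.
  case: cid => l /= Pli; congr (s _ i).
  by apply: Pdisj => //; exists i.
- apply/kernel_filter_eq/sUF => k _; apply/reduced_productP.
  by have := congr1 (fun x => x k) pab.
Qed.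

End KernelFilter.

Theorem corollary6 (I : Type) (A : I -> groupType) (C : groupType)
    (h : {multiplicative (forall i, A i) -> C}) :
  let cond_a := forall J : nat -> set I,
    trivIset setT J -> \bigcup_m J m = setT ->
    exists m, subprod A (J m) `<=` kernel h in
  let cond_b := exists (n : nat) (U : 'I_n -> set_system I)
      (UU : forall k, UltraFilter (U k)), factors_through_ultraproducts h U in
  (cond_a <-> cond_b) /\
  (cond_b ->
    Filter (kernel_filter h) /\
    exists S : set (set_system I),
      unique (fun S => factoring_ultrafilters h S /\
        forall S', factoring_ultrafilters h S' -> S `<=` S') S /\
      kernel_filter h = \bigcap_(U in S) U).
Proof.
move=> cond_a cond_b.
have FF := kernel_filter_filter I A C h.
pose S := [set U | UltraFilter U /\ kernel_filter h `<=` U].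
have FS : kernel_filter h = \bigcap_(U in S) U.
  exact: filter_bigcap_ultrafilters.
have S_least S' : factoring_ultrafilters h S' -> S `<=` S'.
  move=> [n [V [UV [<- /factors_bigcap_sub sVF]]]] U [UU sFU].
  have [k <-] := bigcap_ultrafilters_sub _ _ _ _ UV UU (subset_trans sVF sFU).
  by exists k.
have S_factoring : finite_set S -> factoring_ultrafilters h S.
  move=> /(@finite_seqP (set_system I : eqType))[s Ss].
  (* Without repetitions the enumeration [U] is injective, so its members have disjoint sets. *)
  pose U (k : 'I_(size (undup s))) := tnth (in_tuple (undup s)) k.
  have rangeU : range U = S.
    rewrite Ss; apply/seteqP; split=> [_ [k _ <-] /=|V /= sV].
      by rewrite -mem_undup; exact: mem_tnth.
    rewrite -mem_undup in sV; have /tnthP[k ->] : V \in in_tuple (undup s) by [].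
    by exists k.
  have UU k : UltraFilter (U k).
    by suff [] : S (U k) by []; rewrite -rangeU; exists k.
  exists (size (undup s)), U, UU; split=> //.
  apply: bigcap_sub_factors.
    by move=> k l; apply/tuple_uniqP/undup_uniq.
  by rewrite FS -rangeU => J UJ _ [k _ <-]; exact: UJ.
have b_factoring : cond_b -> factoring_ultrafilters h S.
  move=> [n [V [UV hV]]]; apply: S_factoring.
  apply: (@sub_finite_set _ _ (range V)); last exact: finite_image.
  by apply: S_least; exists n, V, UV.
split; first split.
- move=> ha; suff /S_factoring[n [U [UU [_ hU]]]] : finite_set S.
    by exists n, U, UU.
  apply: contrapT => Sinf.
  have [|J [Jdisj Jcover SJ]] := infinite_ultrafilters_partition _ _ _ Sinf.
    by move=> U [].
  (* The complement of [J m] is in the kernel filter, hence in an ultrafilter that contains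
     [J m]. *)
  have [m Jm] := ha J Jdisj Jcover; have [U [UU sFU] UJ] := SJ m.
  have UJC : U (~` J m) by apply: sFU; rewrite /kernel_filter /= setCK.
  by have [i []] := filter_ex (filterI UJ UJC).
- move=> [n [U [UU hU]]] J Jdisj _; apply: contrapT => nJ.
  (* A piece in no [U k] has its complement in all of them, so its subproduct lies in the kernel.
     Disjoint pieces need distinct [k], but there are only [n]. *)
  have /choice[f UfJ] m : exists k, U k (J m).
    apply/not_existsP => nUJ; apply: nJ; exists m.
    rewrite -[J m]setCK; apply: (factors_bigcap_sub _ _ _ _ _ _ _ hU) => k _.
    by have [/nUJ|] := in_ultra_setVsetC (J m) (UU k).
  have f_inj : injective f.
    move=> m l fml; apply: Jdisj => //.
    by apply: (@filter_ex _ (U (f m))); apply: filterI; rewrite // fml.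
  have /leq_card : injective (f \o @nat_of_ord n.+1).
    exact: inj_comp f_inj (@ord_inj _).
  by rewrite !card_ord ltnn.
- move=> /b_factoring SF; split=> //; exists S; split=> //.
  split=> // S' [S'F S'_least]; apply/seteqP; split; first exact: S_least.
  exact: S'_least.
Qed.
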